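(* Let $X$ be a simplicial complex and let $X'$ be a subcomplex of $X$. Then for every integer $k\geq 0$ and every $1\leq i\leq f_k(X')$, \[ \lambda_i(L_k(X'))\geq \lambda_i(L_k(X))-(k+2)\max_{\sigma\in X'(k)}\bigl(\deg_X(\sigma)-\deg_{X'}(\sigma)\bigr). \]
   Context: A simplicial complex $X$ on a finite vertex set $V$ is a collection of subsets of $V$ containing every singleton and closed under subsets; a subcomplex is a simplicial complex whose faces all lie in $X$. $X(k)$ is the set of faces of size $k+1$, $f_k(X)=|X(k)|$, and for $\sigma\in X(k)$, $\deg_X(\sigma)=|\{\tau\in X(k+1)\mid\sigma\subset\tau\}|$. Fix a linear order $<$ on $V$. For $\sigma\in X(k-1)$, $\tau\in X(k)$ with $\sigma\subset\tau$, let $(\tau:\sigma)=(-1)^{|\{v\in\tau\mid v<u\}|}$ where $\{u\}=\tau\setminus\sigma$. The boundary map $\partial_k(X)\in\mathbb{R}^{X(k-1)\times X(k)}$ has entry $(\tau:\sigma)$ if $\sigma\subset\tau$ and $0$ otherwise; $L_k(X)=\partial_{k+1}(X)\partial_{k+1}(X)^T+\partial_k(X)^T\partial_k(X)$. $\lambda_i(M)$ denotes the $i$-th smallest eigenvalue of a symmetric matrix $M$. *)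

(* Defs.v *)
From HB Require Import structures.
From mathcomp Require Import all_boot all_order all_algebra.
From mathcomp Require Import polyrcf.

Set Implicit Arguments.
Unset Strict Implicit.
Unset Printing Implicit Defensive.

Import Order.TTheory GRing.Theory Num.Theory.

Local Open Scope ring_scope.

Section Complexes.
Variables (d : Order.disp_t) (T : finOrderType d).
Implicit Types (V s t : {set T}) (X : {set {set T}}).

(* A subcomplex may have fewer vertices, so the vertex set V is a subset of an
   ambient ordered finite type T, which provides the linear order. *)
Definition simplicial_complex V X : Prop :=
  [/\ forall s, s \in X -> s \subset V,
      forall v, v \in V -> [set v] \in X
    & forall s t, s \in X -> t \subset s -> t \in X].

(* Faces are indexed by cardinality: X(k) is [faces X k.+1], and X(-1), which
   contains the empty face, is [faces X 0]. *)
Definition faces X (n : nat) : {set {set T}} := [set s in X | #|s| == n].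

Definition fnum X (k : nat) : nat := #|faces X k.+1|.

Definition deg X s : nat := #|[set t in faces X #|s|.+1 | s \subset t]|.

(* The sign (t : s), where t :\: s is a singleton; the [None] branch is
   reached only if t is included in s. *)
Definition incidence (R : pzRingType) t s : R :=
  if [pick u in t :\: s] is Some u
  then (-1) ^+ #|[set v in t | (v < u)%O]| else 0.

Definition face X n (i : 'I_#|faces X n|) : {set T} := enum_val i.

(* The matrix of the boundary map from R^X(k) to R^X(k-1). *)
Definition boundary (R : pzRingType) X (k : nat) :
    'M[R]_(#|faces X k|, #|faces X k.+1|) :=
  \matrix_(i, j)
    (if face i \subset face j then incidence R (face j) (face i) else 0).

Definition laplacian (R : pzRingType) X (k : nat) : 'M[R]_#|faces X k.+1| :=
  boundary R X k.+1 *m (boundary R X k.+1)^T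
  + (boundary R X k)^T *m boundary R X k.

End Complexes.

Section Eigenvalues.
Variable R : rcfType.

(* The roots in R of the characteristic polynomial, repeated according to
   multiplicity, in nondecreasing order. A symmetric n x n matrix has exactly n
   of them. *)
Definition eigenvalues n (M : 'M[R]_n) : seq R :=
  let p := char_poly M in
  sort <=%R (flatten [seq nseq (mup x p) x | x <- rootsR p]).

(* The i-th smallest eigenvalue, counted from i = 1. *)
Definition lambda n (i : nat) (M : 'M[R]_n) : R := (eigenvalues M)`_i.-1.

End Eigenvalues.

(* Main.v *)
(* Extend x in R^X'(k) by zero to R^X(k). The lower parts of the two Laplacian
   forms agree on x, because the facets of a face of X' lie in X'; the upper
   parts differ by the sum over t in X(k+1) \ X'(k+1) of the squares of
   \sum_(s in X'(k), s \subset t) +- x_s, and by Cauchy-Schwarz this is at most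
   (k+2) max (deg_X - deg_X') |x|^2. The Courant-Fischer argument turns this
   comparison of forms into the comparison of eigenvalues. Since the library's
   spectral theorem is for Hermitian matrices, forms are taken over R[i]. *)
Require Import Defs.
From mathcomp Require Import all_boot all_order all_algebra.
From mathcomp Require Import reals.
From mathcomp Require Import polyrcf complex.
Import Order.TTheory GRing.Theory Num.Theory.
Local Open Scope ring_scope.

Set Implicit Arguments.
Unset Strict Implicit.
Unset Printing Implicit Defensive.

(** * Hermitian forms and their comparison through eigenvectors *)

Section QuadraticForms.
Variable C : numClosedFieldType.
Local Open Scope sesquilinear_scope.

Definition sqnorm n (x : 'rV[C]_n) : C := \sum_j `|x 0 j| ^+ 2.

Definition qform n (A : 'M[C]_n) (x : 'rV[C]_n) : C := (x *m A *m x ^t*) 0 0.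

Lemma sqnormE n (x : 'rV[C]_n) : (x *m x ^t*) 0 0 = sqnorm x.
Proof. by rewrite mxE; apply: eq_bigr => j _; rewrite !mxE normCK. Qed.

Lemma qform_diag n (d : 'rV[C]_n) x :
  qform (diag_mx d) x = \sum_j d 0 j * `|x 0 j| ^+ 2.
Proof.
rewrite /qform mul_mx_diag mxE; apply: eq_bigr => j _.
by rewrite !mxE normCK mulrCA mulrA.
Qed.

Lemma sqnorm_gt0 n (x : 'rV[C]_n) : x != 0 -> 0 < sqnorm x.
Proof.
move=> xn0; rewrite lt0r sumr_ge0 ?andbT => [|j _]; last exact: exprn_ge0.
apply: contra_neq xn0 => /eqP; rewrite psumr_eq0 => [|j _]; last first.
  exact: exprn_ge0.
move/allP => x0; apply/rowP => j; rewrite mxE; apply/eqP.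
by have := x0 j (mem_index_enum j); rewrite /= sqrf_eq0 normr_eq0.
Qed.

Lemma qform_spectral n (A : 'M[C]_n) x : A \is hermsymmx ->
  qform A x = qform (diag_mx (spectral_diag A)) (x *m (spectralmx A) ^t*).
Proof.
move=> /hermitian_normalmx /orthomx_spectralP {1}->.
rewrite /qform (invmx_unitary (spectral_unitarymx A)) trmx_mul map_mxM trmxCK.
by rewrite !mulmxA.
Qed.

Lemma sqnorm_unitary n (P : 'M[C]_n) x : P \is unitarymx ->
  sqnorm (x *m P) = sqnorm x.
Proof.
move=> /unitarymxP PP; rewrite -!sqnormE trmx_mul map_mxM mulmxA.
by rewrite -(mulmxA x) PP mulmx1.
Qed.

(* By a dimension count, some x <> 0 lies in the span of the eigenvectors of B
   with eigenvalue <= s while x *m J lies in the span of those of A with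
   eigenvalue >= t. *)
Lemma spectral_comparison m n (B : 'M[C]_m) (A : 'M[C]_n) (J : 'M[C]_(m, n))
    (c s t : C) : B \is hermsymmx -> A \is hermsymmx ->
    (forall x, sqnorm (x *m J) = sqnorm x) ->
    (forall x, qform A (x *m J) <= qform B x + c * sqnorm x) ->
    (#|[set j | ~~ (spectral_diag B 0 j <= s)%R]|
      + #|[set j | ~~ (t <= spectral_diag A 0 j)%R]| < m)%N ->
  t <= s + c.
Proof.
move=> hB hA isoJ leAB.
set b := [set j | _]; set a := [set j | _] => ltm.
pose QB := (spectralmx B) ^t*; pose QA := (spectralmx A) ^t*.
(* The columns of [K] compute the coordinates that must vanish: those of [x] indexed by [b] in the
   eigenbasis of [B], and those of [x *m J] indexed by [a] in the eigenbasis of [A]. There are fewer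
   than [m] of them, so [K] has a nonzero left kernel. *)
pose K := row_mx (colsub (@enum_val _ (mem b)) QB)
                 (colsub (@enum_val _ (mem a)) (J *m QA)).
have : kermx K != 0.
  rewrite kermx_eq0 /row_free neq_ltn (leq_ltn_trans _ ltm) //.
  exact: rank_leq_col.
case/rowV0Pn => x /sub_kermxP; rewrite mul_mx_row => /eqP.
rewrite row_mx_eq0 => /andP[/eqP xB /eqP xA] xn0.
have yB j : j \in b -> (x *m QB) 0 j = 0.
  move=> jb; have /rowP/(_ (enum_rank_in jb j)) := xB.
  rewrite [RHS]mxE => <-; rewrite mxE [RHS]mxE.
  by apply: eq_bigr => l _; rewrite [in RHS]mxE (enum_rankK_in jb).
have yA j : j \in a -> (x *m J *m QA) 0 j = 0.
  move=> ja; have /rowP/(_ (enum_rank_in ja j)) := xA.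
  rewrite -mulmxA [RHS]mxE => <-; rewrite mxE [RHS]mxE.
  by apply: eq_bigr => l _; rewrite [in RHS]mxE (enum_rankK_in ja).
have uQ k (M : 'M[C]_k) : (spectralmx M) ^t* \is unitarymx.
  by rewrite trmxC_unitary spectral_unitarymx.
rewrite -(ler_pM2r (sqnorm_gt0 xn0)) mulrDl.
(* With N the squared norm of [x], the form of [A] at [x *m J] is at least tN and at most (s + c)N.
   In eigencoordinates every term whose eigenvalue is on the wrong side of [s] or [t] has a zero
   coordinate. *)
apply: (@le_trans _ _ (qform A (x *m J))); last first.
  apply: (le_trans (leAB x)); rewrite lerD2r qform_spectral // qform_diag.
  rewrite -(sqnorm_unitary x (uQ _ B)) mulr_sumr; apply: ler_sum => j _.
  have [/yB ->|] := boolP (j \in b); first by rewrite normr0 expr0n !mulr0.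
  by rewrite inE negbK => ?; rewrite ler_wpM2r ?exprn_ge0.
rewrite qform_spectral // qform_diag -isoJ.
rewrite -(sqnorm_unitary (x *m J) (uQ _ A)) mulr_sumr; apply: ler_sum => j _.
have [/yA ->|] := boolP (j \in a); first by rewrite normr0 expr0n !mulr0.
by rewrite inE negbK => ?; rewrite ler_wpM2r ?exprn_ge0.
Qed.

(** Cauchy-Schwarz against the constant 1: both sides become double sums over [P], compared termwise
    by ab <= (a^2 + b^2) / 2. *)
Lemma sqr_norm_sum_le (I : finType) (P : {pred I}) (z : I -> C) :
  `|\sum_(i in P) z i| ^+ 2 <= #|P|%:R * \sum_(i in P) `|z i| ^+ 2.
Proof.
apply: (@le_trans _ _ ((\sum_(i in P) `|z i|) ^+ 2)).
  by rewrite lerXn2r ?nnegrE ?sumr_ge0 // ler_norm_sum.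
rewrite expr2 big_distrlr /=.
have -> : #|P|%:R * \sum_(i in P) `|z i| ^+ 2
    = \sum_(i in P) \sum_(j in P) (`|z i| ^+ 2 + `|z j| ^+ 2) / 2.
  under [RHS]eq_bigr do rewrite -mulr_suml big_split /= sumr_const.
  rewrite -mulr_suml big_split /= sumr_const sumrMnl -mulr2n.
  by rewrite -[X in _ = X / _]mulr_natr mulfK ?pnatr_eq0 // mulr_natl.
apply: ler_sum => i _; apply: ler_sum => j _.
rewrite ler_pdivlMr ?ltr0n // mulr_natr -subr_ge0 addrAC -sqrrB.
by apply: real_exprn_even_ge0; rewrite ?realB.
Qed.

End QuadraticForms.

(** * Sorted lists of eigenvalues and counting *)

Section SortedSpectrum.
Variable R : rcfType.

(** When the characteristic polynomial splits, the multiplicity of each root is its number of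
    occurrences in [s], so the two lists are permutations of each other. *)
Lemma eigenvalues_prod n (M : 'M[R]_n) (s : seq R) :
  char_poly M = \prod_(x <- s) ('X - x%:P) -> eigenvalues M = sort <=%R s.
Proof.
move=> charM; apply/(perm_sortP le_total le_trans le_anti).
have p0 : char_poly M != 0 by rewrite monic_neq0 ?char_poly_monic.
have mupE y : mup y (char_poly M) = count_mem y s.
  rewrite charM; elim: s {charM p0} => [|x s IHs].
    by rewrite big_nil mupNroot // root1.
  rewrite big_cons mupM ?polyXsubC_eq0 //; last first.
    by rewrite monic_neq0 // monic_prod_XsubC.
  by rewrite -['X - _]expr1 mup_XsubCX IHs /=; case: eqVneq.
apply/allP => y _; apply/eqP; rewrite -mupE.
have [ry|ry] := boolP (y \in rootsR (char_poly M)); last first.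
  rewrite mupNroot; last first.
    by apply: contra ry; rewrite -roots_on_rootsR // => ->; rewrite in_itv.
  apply/count_memPn; apply: contra ry => /flattenP[l /mapP[x xr ->]].
  by rewrite mem_nseq => /andP[_ /eqP->].
rewrite count_flatten -map_comp sumnE big_map.
rewrite (bigD1_seq y) ?uniq_roots //= count_nseq /= eqxx mul1n.
by rewrite big1 ?addn0 // => x /negPf xy; rewrite count_nseq /= xy.
Qed.

(** If at most [i] entries were below or equal to the entry at position [i], that entry would be
    strictly greater than itself. The next lemma is the dual count from above; repeated values are
    harmless in both. *)
Lemma count_le_sort_nth (s : seq R) (i : nat) : (i < size s)%N ->
  (i < count (fun x => x <= (sort <=%R s)`_i)%R s)%N.
Proof.
move=> ltis; set x : R := (sort _ _)`_i.
have -> : count (fun y => y <= x) s = count (<= x) (sort <=%R s).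
  by rewrite count_sort.
rewrite ltnNge; apply/negP => le_i.
have := @nth_count_gt _ _ x 0 _ i (sort_le_sorted s).
by rewrite le_i size_sort ltis ltxx => /(_ isT).
Qed.

Lemma count_ge_sort_nth (s : seq R) (i : nat) : (i < size s)%N ->
  (size s - i <= count (fun x => (sort <=%R s)`_i <= x)%R s)%N.
Proof.
move=> ltis; set x : R := (sort _ _)`_i.
have -> : count (fun y => x <= y) s = count (>= x) (sort <=%R s).
  by rewrite count_sort.
rewrite leq_subLR addnC -leq_subLR -{1}(size_sort <=%R s) -count_lt_ge.
rewrite leqNgt; apply/negP => lt_i.
by have := nth_count_lt 0 (sort_le_sorted s) lt_i; rewrite ltxx.
Qed.

End SortedSpectrum.

Lemma count_codom (I : finType) (T : Type) (f : I -> T) (P : pred T) :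
  count P (codom f) = #|[set j | P (f j)]|.
Proof.
by rewrite codomE count_map enumT cardsE cardE /enum_mem size_filter.
Qed.

Lemma char_poly_conj (F : fieldType) n (P D : 'M[F]_n) : P \in unitmx ->
  char_poly (invmx P *m D *m P) = char_poly D.
Proof.
move=> uP; have PVP : map_mx polyC (invmx P) *m map_mx polyC P = 1%:M.
  by rewrite -map_mxM mulVmx // map_mx1.
have -> : char_poly (invmx P *m D *m P)
    = \det (map_mx polyC (invmx P) *m char_poly_mx D *m map_mx polyC P).
  rewrite mulmxBr mulmxBl scalar_mxC -(mulmxA _ (map_mx _ _)) PVP mulmx1.
  by rewrite -!map_mxM.
by rewrite !det_mulmx mulrAC -det_mulmx PVP det1 mul1r.
Qed.

(** * Transfer from complex Hermitian to real symmetric matrices *)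

Section SymmetricMatrices.
Variable R : rcfType.
Local Open Scope sesquilinear_scope.
Local Open Scope complex_scope.

Lemma map_real_conj m n (A : 'M[R]_(m, n)) :
  (map_mx (real_complex R) A) ^ Num.conj = map_mx (real_complex R) A.
Proof. by apply/matrixP => i j; rewrite !mxE; apply: conjc_real. Qed.

Lemma symmetric_hermsymmx n (A : 'M[R]_n) : A^T = A ->
  map_mx (real_complex R) A \is hermsymmx.
Proof.
move=> symA; apply/is_hermitianmxP; rewrite expr0 scale1r -map_trmx.
by rewrite map_real_conj map_trmx symA.
Qed.

(** The complexified matrix is Hermitian, so its spectral diagonal is real. Diagonalization factors
    the characteristic polynomial over the complex numbers, and injectivity of the embedding brings
    this factorization back to [R]. *)
Lemma symmetric_eigenvalues n (A : 'M[R]_n) : A^T = A ->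
  exists2 d : 'I_n -> R,
    (forall j, spectral_diag (map_mx (real_complex R) A) 0 j = (d j)%:C)
  & eigenvalues A = sort <=%R (codom d).
Proof.
move=> symA; set AC := map_mx _ _; have hA := symmetric_hermsymmx symA.
have dE j : spectral_diag AC 0 j = (complex.Re (spectral_diag AC 0 j))%:C.
  have /mxOverP/(_ 0 j) := hermitian_spectral_diag_real hA.
  by move/RRe_real.
exists (fun j => complex.Re (spectral_diag AC 0 j)) => //.
apply: eigenvalues_prod; apply: (map_poly_inj (real_complex R)).
rewrite map_char_poly.
have /hermitian_normalmx /orthomx_spectralP eqAC := hA.
rewrite eqAC char_poly_conj ?spectral_unit // char_poly_trig; last first.
  exact/diag_mx_is_trig.
rewrite rmorph_prod codomE big_map big_enum /=; apply: eq_bigr => j _.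
by rewrite map_polyXsubC mxE eqxx mulr1n; congr ('X - _%:P); apply: dE.
Qed.

Lemma lambda_comparison m n (B : 'M[R]_m) (A : 'M[R]_n)
    (J : 'M[R[i]]_(m, n)) (c : R) (i : nat) :
    B^T = B -> A^T = A -> (1 <= i <= m)%N ->
    (forall x, sqnorm (x *m J) = sqnorm x) ->
    (forall x, qform (map_mx (real_complex R) A) (x *m J)
      <= qform (map_mx (real_complex R) B) x + c%:C * sqnorm x) ->
  lambda i A <= lambda i B + c.
Proof.
(* From here [i] is a position counted from 0. *)
move=> symB symA; case: i => // i /andP[_ ltim] isoJ leAB; rewrite /lambda /=.
have [b bE ->] := symmetric_eigenvalues symB.
have [a aE ->] := symmetric_eigenvalues symA.
(* [J] preserves norms, hence is injective; this makes [i] a valid position in the spectrum of [A]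
   too. *)
have lemn : (m <= n)%N.
  have <- : \rank J = m; last exact: rank_leq_col.
  apply/eqP; rewrite -/(row_free J) -kermx_eq0; apply/rowV0P => x.
  move=> /sub_kermxP xJ; apply/eqP; apply: contraT => /sqnorm_gt0.
  rewrite -isoJ xJ /sqnorm big1 ?ltxx // => j _.
  by rewrite mxE normr0 expr0n.
have sb : size (codom b) = m by rewrite size_codom card_ord.
have sa : size (codom a) = n by rewrite size_codom card_ord.
set lb : R := (sort <=%R (codom b))`_i; set la : R := (sort <=%R (codom a))`_i.
have countb : (i < #|[set j | (b j <= lb)%R]|)%N.
  have /count_le_sort_nth : (i < size (codom b))%N by rewrite sb.
  by rewrite count_codom.
have counta : (n - i <= #|[set j | (la <= a j)%R]|)%N.
  have /count_ge_sort_nth : (i < size (codom a))%N.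
    by rewrite sa (leq_trans ltim).
  by rewrite sa count_codom.
rewrite -lecR rmorphD /=; apply: (spectral_comparison _ _ isoJ leAB).
- exact: symmetric_hermsymmx.
- exact: symmetric_hermsymmx.
set S := [set j | _]; set S' := [set j | _].
have -> : #|S| = (m - #|[set j | (b j <= lb)%R]|)%N.
  rewrite cardsCs card_ord; congr (_ - #|pred_of_set _|)%N.
  by apply/setP => j; rewrite !inE negbK bE lecR.
have -> : #|S'| = (n - #|[set j | (la <= a j)%R]|)%N.
  rewrite cardsCs card_ord; congr (_ - #|pred_of_set _|)%N.
  by apply/setP => j; rewrite !inE negbK aE lecR.
(* At most [i] eigenvalues of [A] are below [la], and fewer than [m - i] of those of [B] are above
   [lb]. *)
apply: (@leq_ltn_trans (m - #|[set j | (b j <= lb)%R]| + i)).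
  by rewrite leq_add2l leq_subCl.
by rewrite addnC -ltn_subRL ltn_sub2l.
Qed.

End SymmetricMatrices.

(** * The Laplacian form as a sum of squares *)

Section LaplacianForm.
Variables (d : Order.disp_t) (T : finOrderType d).
Implicit Types (X : {set {set T}}) (s t : {set T}).

(** Boundary entries indexed by sets rather than by positions in an enumeration, so that they are
    shared by a complex and its subcomplex. *)
Definition boundary_coef (R : pzRingType) t s : R :=
  if s \subset t then incidence R t s else 0.

Lemma rmorph_boundary_coef (R S : pzRingType) (f : {rmorphism R -> S}) t s :
  f (boundary_coef R t s) = boundary_coef S t s.
Proof.
rewrite /boundary_coef /incidence; case: ifP => _; last exact: rmorph0.
by case: pickP => [u _|_]; rewrite ?rmorph0 ?rmorphXn ?rmorphN1.
Qed.

Lemma norm_boundary_coef_le (R : numDomainType) t s :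
  `|boundary_coef R t s| <= (s \subset t)%:R.
Proof.
rewrite /boundary_coef /incidence; case: ifP => _; last by rewrite normr0.
by case: pickP => [u _|_]; rewrite ?normr0 ?ler01 // normrX normrN1 expr1n.
Qed.

Lemma laplacian_sym (R : comPzRingType) X k :
  (laplacian R X k)^T = laplacian R X k.
Proof. by rewrite /laplacian linearD /= !trmx_mul !trmxK. Qed.

Variable R : rcfType.
Local Open Scope sesquilinear_scope.
Local Notation C := R[i]%C.
Implicit Type g : {set T} -> C.

Lemma sum_face X n (V : nmodType) (F : {set T} -> V) :
  \sum_(i < #|faces X n|) F (face i) = \sum_(s in faces X n) F s.
Proof. exact/esym/big_enum_val. Qed.

Lemma qform_laplacian X k g :
  qform (map_mx (real_complex R) (laplacian R X k)) (\row_i g (face i)) =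
    \sum_(t in faces X k.+2) `|\sum_(s in faces X k.+1) g s * boundary_coef C t s| ^+ 2
  + \sum_(r in faces X k) `|\sum_(s in faces X k.+1) g s * boundary_coef C s r| ^+ 2.
Proof.
set D := map_mx (real_complex R) (boundary R X k.+1).
set D' := map_mx (real_complex R) (boundary R X k).
have -> : map_mx (real_complex R) (laplacian R X k) = D *m D^T + D'^T *m D'.
  by rewrite map_mxD !map_mxM /= !map_trmx.
have DC : D ^t* = D^T by rewrite -map_trmx map_real_conj.
have D'C : (D'^T) ^t* = D' by rewrite trmxK map_real_conj.
set x := \row_i _.
have -> : qform (D *m D^T + D'^T *m D') x
    = sqnorm (x *m D) + sqnorm (x *m D'^T).
  rewrite -!sqnormE /qform !trmx_mul !map_mxM DC D'C mulmxDr mulmxDl mxE.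
  by rewrite !mulmxA.
congr (_ + _).
  rewrite -sum_face; apply: eq_bigr => j _; congr (`|_| ^+ 2).
  rewrite -sum_face mxE; apply: eq_bigr => i _; rewrite !mxE.
  by rewrite -[LHS]/(_ * real_complex R (boundary_coef R _ _)) rmorph_boundary_coef.
rewrite -sum_face; apply: eq_bigr => j _; congr (`|_| ^+ 2).
rewrite -sum_face mxE; apply: eq_bigr => i _; rewrite !mxE.
by rewrite -[LHS]/(_ * real_complex R (boundary_coef R _ _)) rmorph_boundary_coef.
Qed.

End LaplacianForm.

(** * Comparison of a complex with its subcomplex *)

Section Comparison.
Variables (d : Order.disp_t) (T : finOrderType d).
Implicit Types (X D : {set {set T}}) (s t : {set T}).

Lemma sum_subset (I : finType) (V : nmodType) (A B : {set I}) (F : I -> V) :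
    A \subset B -> {in B :\: A, forall i, F i = 0} ->
  \sum_(i in B) F i = \sum_(i in A) F i.
Proof.
move=> sAB F0; rewrite (big_setID A) /= (setIidPr sAB).
by rewrite [X in _ + X]big1 ?addr0.
Qed.

(** Each [t] in [D] has at most k+2 subsets of size k+1 in [X], which gives the Cauchy-Schwarz
    factor. After exchanging the sums, each face [s] is counted at most [M] times. *)
Lemma coface_form_le (C : numClosedFieldType) X D k M (g : {set T} -> C) :
    {in D, forall t, #|t| = k.+2} ->
    {in faces X k.+1, forall s, #|[set t in D | s \subset t]| <= M}%N ->
  \sum_(t in D) `|\sum_(s in faces X k.+1) g s * boundary_coef C t s| ^+ 2
    <= k.+2%:R * M%:R * \sum_(s in faces X k.+1) `|g s| ^+ 2.
Proof.
move=> cardD leM; rewrite -mulrA [M%:R * _]mulr_sumr.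
apply: (@le_trans _ _ (k.+2%:R * \sum_(t in D)
    \sum_(s in faces X k.+1 | s \subset t) `|g s| ^+ 2)); last first.
  rewrite ler_wpM2l // (exchange_big_dep (mem (faces X k.+1))) /=; last first.
    by move=> t s _ /andP[].
  apply: ler_sum => s sX; rewrite (eq_bigl (mem [set t in D | s \subset t])).
    by rewrite sumr_const mulr_natl ler_wpMn2l ?exprn_ge0 ?leM.
  by move=> t; rewrite sX /= inE.
rewrite mulr_sumr; apply: ler_sum => t tD.
pose P := [set s in faces X k.+1 | s \subset t].
have -> : \sum_(s in faces X k.+1) g s * boundary_coef C t s
    = \sum_(s in P) g s * boundary_coef C t s.
  apply: sum_subset => [|s].
    by apply/subsetP => s; rewrite inE => /andP[].
  rewrite !inE => /andP[/negP nst sX].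
  rewrite /boundary_coef; case: ifP => [st|_]; last by rewrite mulr0.
  by case: nst; rewrite sX.
apply: (le_trans (sqr_norm_sum_le _ _)).
have leP : (#|P| <= k.+2)%N.
  have <- : 'C(#|t|, k.+1) = k.+2 by rewrite cardD // binSn.
  rewrite -cards_draws.
  apply/subset_leq_card/subsetP => s; rewrite !inE.
  by case/andP => /andP[_ ->] ->.
rewrite (eq_bigl (fun s => s \in P) (fun s => `|g s| ^+ 2)) => [|s]; last first.
  by rewrite !inE.
apply: ler_pM; rewrite ?ler_nat ?sumr_ge0 //.
  by move=> s _; rewrite exprn_ge0.
apply: ler_sum => s _; rewrite lerXn2r ?nnegrE // normrM ler_piMr //.
by apply: (le_trans (norm_boundary_coef_le _ _ _)); case: (_ \subset _).
Qed.

Lemma card_new_cofaces X X' s : X' \subset X ->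
  #|[set t in faces X #|s|.+1 :\: faces X' #|s|.+1 | s \subset t]|
    = (deg X s - deg X' s)%N.
Proof.
move=> sX; rewrite /deg -(cardsID [set t in faces X' #|s|.+1 | s \subset t]
  [set t in faces X _ | _]).
rewrite (setIidPr _); last first.
  apply/subsetP => t; rewrite !inE => /andP[/andP[tX ->] ->].
  by rewrite (subsetP sX).
rewrite addKn; apply: eq_card => t; rewrite !inE.
by case: (s \subset t); rewrite ?andbF ?andbT.
Qed.

End Comparison.

(* As X' is included in X, deg X' s <= deg X s, so the subtraction of natural
   numbers below is never truncated; the maximum is over a nonempty set, since
   1 <= i <= fnum X' k. *)
Theorem theorem1p7 (R : realType) (d : Order.disp_t) (T : finOrderType d)
    (V V' : {set T}) (X X' : {set {set T}})
    (hX : simplicial_complex V X) (hX' : simplicial_complex V' X')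
    (hsub : X' \subset X) (k i : nat) (hi : (1 <= i <= fnum X' k)%N) :
  lambda i (laplacian R X' k) >=
  lambda i (laplacian R X k)
  - (k + 2)%:R * (\max_(s in faces X' k.+1) (deg X s - deg X' s))%N%:R.
Proof.
rewrite lerBlDr; set M := (\max_(s in _) _)%N.
have subF n : faces X' n \subset faces X n.
  by apply/subsetP => s; rewrite !inE => /andP[/(subsetP hsub) -> ->].
pose J : 'M[R[i]%C]_(#|faces X' k.+1|, #|faces X k.+1|) :=
  \matrix_(a, b) (face a == face b)%:R.
(* [g x] is [x] extended by zero to all sets, so both [x] and [x *m J] are restrictions of one
   function and sums over the two face sets can be compared directly. *)
pose g (x : 'rV[R[i]%C]_#|faces X' k.+1|) s := \sum_a x 0 a * (face a == s)%:R.
have g0 x s : s \notin faces X' k.+1 -> g x s = 0.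
  move=> sX'; rewrite /g big1 // => a _.
  case: eqP => [as_|_]; last exact: mulr0.
  by rewrite -as_ enum_valP in sX'.
have xE x : x = \row_a g x (face a).
  apply/rowP => a; rewrite mxE /g (bigD1 a) //= eqxx mulr1.
  rewrite big1 ?addr0 // => b ba.
  by rewrite (inj_eq enum_val_inj) (negPf ba) mulr0.
have xJ x : x *m J = \row_b g x (face b).
  by apply/rowP => b; rewrite !mxE; apply: eq_bigr => a _; rewrite mxE.
have normE Y x : sqnorm (\row_(b < #|faces Y k.+1|) g x (face b))
    = \sum_(s in faces Y k.+1) `|g x s| ^+ 2.
  by rewrite -sum_face; apply: eq_bigr => b _; rewrite mxE.
have sumg (U : nmodType) x (F : {set T} -> U) :
    (forall s, g x s = 0 -> F s = 0) ->
    \sum_(s in faces X k.+1) F s = \sum_(s in faces X' k.+1) F s.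
  by move=> F0; apply: sum_subset => // s /setDP[_ /(g0 x)]; apply: F0.
apply: (@lambda_comparison _ _ _ _ _ J) => // [||x|x].
- exact: laplacian_sym.
- exact: laplacian_sym.
- rewrite xJ [in RHS](xE x) !normE; apply: (sumg _ x) => s ->.
  by rewrite normr0 expr0n.
rewrite xJ [in X in _ <= qform _ X + _](xE x) [in sqnorm x](xE x).
rewrite !qform_laplacian normE.
pose bx t := \sum_(s in faces X' k.+1) g x s * boundary_coef R[i]%C t s.
pose cx r := \sum_(s in faces X' k.+1) g x s * boundary_coef R[i]%C s r.
have -> : \sum_(t in faces X k.+2)
      `|\sum_(s in faces X k.+1) g x s * boundary_coef R[i]%C t s| ^+ 2
    = \sum_(t in faces X k.+2) `|bx t| ^+ 2.
  apply: eq_bigr => t _; congr (`|_| ^+ 2).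
  by apply: (sumg _ x) => s ->; rewrite mul0r.
have -> : \sum_(r in faces X k)
      `|\sum_(s in faces X k.+1) g x s * boundary_coef R[i]%C s r| ^+ 2
    = \sum_(r in faces X' k) `|cx r| ^+ 2.
  rewrite -(sum_subset (subF k)) => [|r].
    apply: eq_bigr => r _; congr (`|_| ^+ 2).
    by apply: (sumg _ x) => s ->; rewrite mul0r.
  (* A set [r] outside [X'] lies in no face of [X'], by closure under subsets, so all its
     coefficients vanish. *)
  rewrite !inE => /andP[rX' /andP[_ rk]].
  rewrite /cx big1 ?normr0 ?expr0n // => s.
  rewrite inE => /andP[sX' _]; rewrite /boundary_coef.
  case: ifP => [rs|]; last by rewrite mulr0.
  by case: hX' => _ _ /(_ s r sX' rs) => rX; rewrite rX rk in rX'.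
(* The cofaces in [X'] and the lower terms cancel, leaving only the cofaces that are in [X] but not
   in [X']. *)
rewrite (big_setID (faces X' k.+2)) /= (setIidPr (subF _)) -!addrA lerD2l.
rewrite addrC lerD2l addn2.
rewrite rmorphM !rmorph_nat; apply: coface_form_le => [t|s].
  by rewrite !inE => /andP[_ /andP[_ /eqP]].
move=> sX'; have := sX'; rewrite inE => /andP[_ /eqP sk].
by rewrite -sk card_new_cofaces // (leq_bigmax_cond _ sX').
Qed.
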